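(* If a self-similar $k$-graph $(G,\Lambda)$ (over a finitely aligned $k$-graph $\Lambda$) is pseudo free, then the groupoid $\mathcal{G}_{\mathrm{tight}}(\mathcal{S}_{G,\Lambda})$ is Hausdorff.
   Context: **$k$-graphs.** A $k$-graph is a countable small category $\Lambda$ with a functor $d:\Lambda\to\mathbb{N}^k$ (degree) with the unique factorisation property: if $d(\lambda)=m+n$ there are unique $\mu,\nu$ with $d(\mu)=m$, $d(\nu)=n$, $\lambda=\mu\nu$. $\Lambda^0=d^{-1}(0)$ is identified with the objects (vertices); $r,s$ are range and source, and $\mu\nu$ is defined iff $s(\mu)=r(\nu)$. With $\vee$ the coordinatewise maximum, $\Lambda^{\min}(\mu,\nu)=\{(\alpha,\beta):\mu\alpha=\nu\beta,\ d(\mu\alpha)=d(\mu)\vee d(\nu)\}$. $\Lambda$ is finitely aligned if all $\Lambda^{\min}(\mu,\nu)$ are finite. **Self-similar $k$-graph** $(G,\Lambda)=(G,\Lambda,\varphi)$: a finitely aligned $k$-graph $\Lambda$, a countable discrete group $G$ with identity $e_G$, an action of $G$ on $\Lambda$ by degree-preserving bijections commuting with $r$ and $s$, and a map $\varphi:G\times\Lambda\to G$ such that for all $g,h\in G$, $\mu,\nu\in\Lambda$ (with $s(\mu)=r(\nu)$ where $\mu\nu$ occurs), $v\in\Lambda^0$: $\varphi(gh,\mu)=\varphi(g,h\cdot\mu)\varphi(h,\mu)$; $g\cdot(\mu\nu)=(g\cdot\mu)(\varphi(g,\mu)\cdot\nu)$; $\varphi(g,\mu\nu)=\varphi(\varphi(g,\mu),\nu)$;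 $\varphi(g,v)=g$. It is pseudo free if for every $g\in G\setminus\{e_G\}$ there is no $\mu\in\Lambda$ with $g\cdot\mu=\mu$ and $\varphi(g,\mu)=e_G$. **$\mathcal{S}_{G,\Lambda}$**: elements are the finite sets $F$ of triples $(\mu,g,\nu)\in\Lambda\times G\times\Lambda$ with $s(\mu)=g\cdot s(\nu)$, such that any two distinct triples $(\mu,g,\nu),(\xi,h,\eta)\in F$ satisfy $\Lambda^{\min}(\mu,\xi)=\Lambda^{\min}(\nu,\eta)=\emptyset$. Multiplication: $EF=\bigcup_{(\mu,g,\nu)\in E,(\xi,h,\eta)\in F}\{(\mu(g\cdot\alpha),\varphi(g,\alpha)\varphi(h,h^{-1}\cdot\beta),\eta(h^{-1}\cdot\beta)):(\alpha,\beta)\in\Lambda^{\min}(\nu,\xi)\}$; $F^*=\{(\nu,g^{-1},\mu):(\mu,g,\nu)\in F\}$; zero is $\emptyset$. It is an inverse semigroup with zero. **Tight groupoid.** Let $S$ be an inverse semigroup with $0$, $\mathcal{E}(S)$ its idempotent semilattice with order $e\le f\iff ef=e$. A filter is a nonempty subset of $\mathcal{E}(S)$ closed under products and upward closed; $\widehat{\mathcal{E}}_0(S)$ is the set of filters not containing $0$, topologised by the sets $\{\mathcal{F}:e\in\mathcal{F},e_1,\dots,e_n\notin\mathcal{F}\}$. The tight spectrum $\widehat{\mathcal{E}}_{\mathrm{tight}}(S)$ is the closure in $\widehat{\mathcal{E}}_0(S)$ of the set of its maximal elements (ultrafilters). For $s\in S$, $\theta_s$ is defined on tight filters containing $s^*s$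 by $\theta_s(\mathcal{F})=\{f\in\mathcal{E}(S):f\ge ses^*\text{ for some }e\in\mathcal{F}\}$. $\mathcal{G}_{\mathrm{tight}}(S)$ is the groupoid of germs $[s,\mathcal{F}]$ ($s^*s\in\mathcal{F}$), with $[s,\mathcal{F}]=[t,\mathcal{F}']$ iff $\mathcal{F}=\mathcal{F}'$ and $se=te$ for some $e\in\mathcal{F}$; $[t,\theta_s(\mathcal{F})][s,\mathcal{F}]=[ts,\mathcal{F}]$, $[s,\mathcal{F}]^{-1}=[s^*,\theta_s(\mathcal{F})]$; topology generated by the sets $\{[s,\mathcal{F}]:\mathcal{F}\in U\}$, with $U$ open in the domain of $\theta_s$. *)

(* Defs.v *)
From HB Require Import structures.
From mathcomp Require Import all_boot all_algebra finmap all_classical topology.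
Set Implicit Arguments.
Unset Strict Implicit.
Unset Printing Implicit Defensive.

Local Open Scope classical_set_scope.
Local Open Scope group_scope.

(* Small categories are encoded by their arrows only: an object is identified
   with its identity arrow, [rg x] and [sr x] are the identities of the range
   and of the source of x, and [x ** y] is meaningful only if sr x = rg y. *)
HB.mixin Record isCategory C := {
  rg : C -> C;
  sr : C -> C;
  ccomp : C -> C -> C;
  rg_rg : forall x, rg (rg x) = rg x;
  rg_sr : forall x, rg (sr x) = sr x;
  sr_rg : forall x, sr (rg x) = rg x;
  sr_sr : forall x, sr (sr x) = sr x;
  ccomp_rg : forall x, ccomp (rg x) x = x;
  ccomp_sr : forall x, ccomp x (sr x) = x;
  rg_ccomp : forall x y, sr x = rg y -> rg (ccomp x y) = rg x;
  sr_ccomp : forall x y, sr x = rg y -> sr (ccomp x y) = sr y;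
  ccompA : forall x y z, sr x = rg y -> sr y = rg z ->
    ccomp x (ccomp y z) = ccomp (ccomp x y) z
}.

#[short(type="categoryType")]
HB.structure Definition Category := {C of isCategory C}.

Notation "x ** y" := (ccomp x y) (at level 40, left associativity).

HB.mixin Record Category_isGroupoid C of Category C := {
  cinv : C -> C;
  rg_cinv : forall x : C, rg (cinv x) = sr x;
  sr_cinv : forall x : C, sr (cinv x) = rg x;
  ccompV : forall x : C, x ** cinv x = rg x;
  ccompVx : forall x : C, cinv x ** x = sr x
}.

#[short(type="groupoidType")]
HB.structure Definition Groupoid := {C of Category C & Category_isGroupoid C}.

HB.mixin Record Category_isKGraph (k : nat) L of Category L := {
  kgraph_countable : countable [set: L];
  deg : L -> {ffun 'I_k -> nat};
  deg_id : forall x : L, deg (rg x) = 0%R;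
  deg_comp : forall x y : L, sr x = rg y -> deg (x ** y) = (deg x + deg y)%R;
  unique_factorisation : forall (x : L) (m n : {ffun 'I_k -> nat}),
    deg x = (m + n)%R ->
    exists! yz : L * L, [/\ deg yz.1 = m, deg yz.2 = n,
      sr yz.1 = rg yz.2 & x = yz.1 ** yz.2]
}.

#[short(type="kgraphType")]
HB.structure Definition KGraph (k : nat) :=
  {L of Category L & Category_isKGraph k L}.

Arguments deg {k s}.
Arguments deg_id {k s} x.
Arguments deg_comp {k s} x y.
Arguments unique_factorisation {k s} x m n.

Definition vertex (k : nat) (L : kgraphType k) (v : L) := deg v = 0%R.

Definition deg_join (k : nat) (m n : {ffun 'I_k -> nat}) : {ffun 'I_k -> nat} :=
  [ffun i => maxn (m i) (n i)].

Definition Lmin (k : nat) (L : kgraphType k) (m n : L) : set (L * L) :=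
  [set ab | [/\ sr m = rg ab.1, sr n = rg ab.2, m ** ab.1 = n ** ab.2
              & deg (m ** ab.1) = deg_join (deg m) (deg n)]].

Definition finitely_aligned (k : nat) (L : kgraphType k) :=
  forall m n : L, finite_set (Lmin m n).

(* [ss_act_sr] expresses that the right-hand side of [ss_act_comp] is a
   composable pair. *)
Record self_similar (k : nat) (G : groupType) (L : kgraphType k) := SelfSimilar {
  ss_aligned : finitely_aligned L;
  ss_countable : countable [set: G];
  act : G -> L -> L;
  cocycle : G -> L -> G;
  ss_act1 : forall x, act 1 x = x;
  ss_actM : forall g h x, act (g * h) x = act g (act h x);
  ss_act_deg : forall g x, deg (act g x) = deg x;
  ss_act_rg : forall g x, rg (act g x) = act g (rg x);
  ss_act_srE : forall g x, sr (act g x) = act g (sr x);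
  ss_cocycleM : forall g h x,
    cocycle (g * h) x = cocycle g (act h x) * cocycle h x;
  ss_act_sr : forall g x y, sr x = rg y ->
    sr (act g x) = rg (act (cocycle g x) y);
  ss_act_comp : forall g x y, sr x = rg y ->
    act g (x ** y) = act g x ** act (cocycle g x) y;
  ss_cocycle_comp : forall g x y, sr x = rg y ->
    cocycle g (x ** y) = cocycle (cocycle g x) y;
  ss_cocycle_vertex : forall g v, vertex v -> cocycle g v = g
}.

Definition pseudo_free (k : nat) (G : groupType) (L : kgraphType k)
    (A : self_similar G L) :=
  forall g : G, g <> 1 -> ~ exists x : L, act A g x = x /\ cocycle A g x = 1.

HB.mixin Record Semigroup_isInvSemigroup0 S of Semigroup S := {
  star : S -> S;
  szero : S;
  mulsKs : forall s : S, s * star s * s = s;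
  starKs : forall s : S, star s * s * star s = star s;
  star_unique : forall s t : S, s * t * s = s -> t * s * t = t -> t = star s;
  mul0s : forall s : S, szero * s = szero;
  muls0 : forall s : S, s * szero = szero
}.

#[short(type="invSemigroup0Type")]
HB.structure Definition InvSemigroup0 :=
  {S of Semigroup S & Semigroup_isInvSemigroup0 S}.

Notation "s ^*" := (star s) : group_scope.

Section KGraphTheory.
Context {k : nat} {L : kgraphType k}.
Implicit Types (a b x y z : L).

Lemma ufact a b a' b' : sr a = rg b -> sr a' = rg b' -> a ** b = a' ** b' ->
  deg a = deg a' -> a = a' /\ b = b'.
Proof.
move=> ab a'b' e da.
have e1 := deg_comp _ _ ab; have e2 := deg_comp _ _ a'b'.
have db : deg b = deg b'.
  apply/ffunP => i; move: (e2); rewrite -e e1 da => /ffunP/(_ i).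
  by rewrite !ffunE => /addnI.
have [p [_ up]] := unique_factorisation _ _ _ e1.
have := up (a, b) (And4 erefl erefl ab erefl).
have /= := up (a', b') (And4 (esym da) (esym db) a'b' e).
by move=> -> [].
Qed.

Lemma ccompI a b b' : sr a = rg b -> sr a = rg b' -> a ** b = a ** b' -> b = b'.
Proof. by move=> h h' e; have [] := ufact h h' e erefl. Qed.

Lemma deg_sr x : deg (sr x) = 0%R.
Proof. by rewrite -rg_sr deg_id. Qed.

Lemma vertexP x : vertex x <-> rg x = x.
Proof.
split=> [v|<-]; last exact: deg_id.
have [//] : rg x = x /\ x = sr x.
by apply: ufact; rewrite ?sr_rg ?rg_sr ?ccomp_rg ?ccomp_sr // deg_id v.
Qed.

Lemma ffun_subnKC (m n : {ffun 'I_k -> nat}) : (forall i, (m i <= n i)%N) ->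
  n = (m + [ffun i => (n i - m i)%N])%R.
Proof.
move=> mn; apply/ffunP => i; rewrite !ffunE.
by rewrite -[RHS]/(m i + (n i - m i))%N subnKC.
Qed.

Lemma Lmin_ext x y a b : sr x = rg a -> sr y = rg b -> x ** a = y ** b ->
  exists ab z, [/\ Lmin x y ab, sr ab.1 = rg z, sr ab.2 = rg z,
    a = ab.1 ** z & b = ab.2 ** z].
Proof.
move=> xa yb e.
pose m := deg_join (deg x) (deg y).
have dm i : (m i <= deg (x ** a) i)%N.
  rewrite ffunE geq_max; apply/andP; split.
    by rewrite deg_comp // ffunE leq_addr.
  by rewrite e deg_comp // ffunE leq_addr.
have [[u z] [[/= du _ uz exa] _]] : exists! yz : L * L, [/\ deg yz.1 = m,
    deg yz.2 = [ffun i => (deg (x ** a) i - m i)%N],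
    sr yz.1 = rg yz.2 & x ** a = yz.1 ** yz.2].
  by apply: unique_factorisation; exact: ffun_subnKC.
have key w c : sr w = rg c -> (forall i, (deg w i <= m i)%N) ->
    w ** c = u ** z ->
    exists c', [/\ sr w = rg c', sr c' = rg z, w ** c' = u & c = c' ** z].
  move=> wc dw ew.
  have [[w' c'] [[/= dw' _ w'c' eu] _]] : exists! yz : L * L,
      [/\ deg yz.1 = deg w, deg yz.2 = [ffun i => (m i - deg w i)%N],
      sr yz.1 = rg yz.2 & u = yz.1 ** yz.2].
    by apply: unique_factorisation; rewrite du; exact: ffun_subnKC.
  have c'z : sr c' = rg z by rewrite -uz eu sr_ccomp.
  have rcz : rg (c' ** z) = rg c' by rewrite rg_ccomp.
  have [e1 e2] : w = w' /\ c = c' ** z.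
    by apply: ufact => //; rewrite ?rcz // ccompA // -eu.
  by exists c'; split => //; rewrite e1.
have [a' [xa' a'z exu ->]] := key x a xa
  (fun i => ltac:(by rewrite ffunE leq_maxl)) exa.
have [b' [yb' b'z eyu ->]] := key y b yb
  (fun i => ltac:(by rewrite ffunE leq_maxr)) (etrans (esym e) exa).
by exists (a', b'), z; split => //; split; rewrite ?exu ?eyu.
Qed.

End KGraphTheory.

Section SelfSimilarTheory.
Context {k : nat} {G : groupType} {L : kgraphType k} (A : self_similar G L).
Local Notation act := (act A).
Local Notation phi := (cocycle A).
Implicit Types (g h : G) (a b m n x y : L).

Lemma actK g x : act g^-1 (act g x) = x.
Proof. by rewrite -ss_actM mulVg ss_act1. Qed.

Lemma actKV g x : act g (act g^-1 x) = x.
Proof. by rewrite -ss_actM mulgV ss_act1. Qed.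

Lemma act_inj g : injective (act g).
Proof. exact: can_inj (actK g). Qed.

Lemma phi1 x : phi 1 x = 1.
Proof.
have /(congr1 (fun g => (phi 1 x)^-1 * g)) := ss_cocycleM A 1 1 x.
by rewrite ss_act1 mulg1 mulKg mulVg => <-.
Qed.

Lemma phiV g x : phi g^-1 (act g x) = (phi g x)^-1.
Proof.
apply: (mulIg (phi g x)).
by rewrite -ss_cocycleM !mulVg phi1.
Qed.

Lemma act_phi_sr g x : act g (sr x) = act (phi g x) (sr x).
Proof.
have := ss_act_sr A g (esym (rg_sr x)).
by rewrite ss_act_srE ss_act_rg rg_sr.
Qed.

Definition SGL_carrier : set (set (L * G * L)) :=
  [set F | [/\ finite_set F,
    forall m g n, F (m, g, n) -> sr m = act g (sr n) &
    forall s t, F s -> F t -> s <> t ->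
      Lmin s.1.1 t.1.1 = set0 /\ Lmin s.2 t.2 = set0]].

Definition SGL_mul (E F : set (L * G * L)) : set (L * G * L) :=
  [set t | exists m g n x h y a b,
    [/\ E (m, g, n), F (x, h, y), Lmin n x (a, b) &
      t = (m ** act g a, phi g a * phi h (act h^-1 b), y ** act h^-1 b)]].

Definition SGL_star (F : set (L * G * L)) : set (L * G * L) :=
  [set t | F (t.2, t.1.2^-1, t.1.1)].

Definition SGL : Type := set_type SGL_carrier.

Implicit Types (E F : set (L * G * L)).

Lemma SGL_starP F m g n : F (m, g, n) <-> SGL_star F (n, g^-1, m).
Proof. by rewrite /SGL_star /= invgK. Qed.

Lemma SGL_src_ext F s t a b : SGL_carrier F -> F s -> F t ->
  sr s.2 = rg a -> sr t.2 = rg b -> s.2 ** a = t.2 ** b -> s = t.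
Proof.
move=> [_ _ oF] Fs Ft sa tb e; apply: contrapT => /(oF _ _ Fs Ft)[_ h].
have [ab [z [+ _ _ _ _]]] := Lmin_ext sa tb e.
by rewrite h.
Qed.

Lemma SGL_rng_ext F s t a b : SGL_carrier F -> F s -> F t ->
  sr s.1.1 = rg a -> sr t.1.1 = rg b -> s.1.1 ** a = t.1.1 ** b -> s = t.
Proof.
move=> [_ _ oF] Fs Ft sa tb e; apply: contrapT => /(oF _ _ Fs Ft)[h _].
have [ab [z [+ _ _ _ _]]] := Lmin_ext sa tb e.
by rewrite h.
Qed.

Lemma SGL_star_closed F : SGL_carrier F -> SGL_carrier (SGL_star F).
Proof.
move=> [fF sF oF]; split.
- have -> : SGL_star F = (fun t => (t.2, t.1.2^-1, t.1.1)) @` F.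
    apply/seteqP; split=> [[[m g] n] /= h|_ [[[m g] n] /= h <-]].
      by eexists; [exact: h|rewrite /= invgK].
    by rewrite -SGL_starP.
  exact: finite_image.
- by move=> m g n /sF /= ->; rewrite actKV.
- move=> [[m g] n] [[m' g'] n'] /= h h' ne.
  have [|//] := oF _ _ h h'.
  by case=> e1 e2 e3; apply: ne; rewrite e1 e3 (invg_inj e2).
Qed.

(* Elements of SGL act as partial bijections of L * G; this representation is
   faithful and multiplicative, which yields the inverse semigroup laws. *)
Definition SGL_rel F (p q : L * G) := exists m g n e,
  [/\ F (m, g, n), sr n = rg e, p.1 = n ** e, q.1 = m ** act g e
    & q.2 = phi g e * p.2].

Lemma SGL_rel_fun F p q q' : SGL_carrier F -> SGL_rel F p q -> SGL_rel F p q' ->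
  q = q'.
Proof.
move: q q' => [q1 q2] [q'1 q'2].
move=> cF [m [g [n [e [Fn ne pe mE q2E]]]]].
move=> [m' [g' [n' [e' [Fn' ne' pe' mE' q2E']]]]].
have ee : n ** e = n' ** e' by rewrite -pe.
have [? ? ?] := SGL_src_ext cF Fn Fn' ne ne' ee; subst m' g' n'.
move: mE q2E mE' q2E' => /= -> -> -> ->.
by have -> := ccompI ne ne' ee.
Qed.

Lemma SGL_rel_star F p q : SGL_carrier F -> SGL_rel F p q ->
  SGL_rel (SGL_star F) q p.
Proof.
move=> [_ sF _] [m [g [n [e [Fn ne pe qe q2]]]]].
exists n, g^-1, m, (act g e); split.
- by rewrite -SGL_starP.
- by rewrite (sF _ _ _ Fn) ne ss_act_rg.
- by [].
- by rewrite actK.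
- by rewrite q2 phiV mulKg.
Qed.

Lemma SGL_starK F : SGL_star (SGL_star F) = F.
Proof. by apply/seteqP; split=> -[[m g] n]; rewrite /SGL_star /= invgK. Qed.

Lemma SGL_rel_inj F p p' q : SGL_carrier F -> SGL_rel F p q -> SGL_rel F p' q ->
  p = p'.
Proof.
move=> cF /(SGL_rel_star cF) h /(SGL_rel_star cF) h'.
exact: SGL_rel_fun (SGL_star_closed cF) h h'.
Qed.

Lemma SGL_relP F m g n : SGL_carrier F -> F (m, g, n) ->
  SGL_rel F (n, 1) (m, g).
Proof.
move=> [_ sF _] Fn; exists m, g, n, (sr n); split=> //=.
- by rewrite rg_sr.
- by rewrite ccomp_sr.
- by rewrite -(sF _ _ _ Fn) ccomp_sr.
- by rewrite mulg1 ss_cocycle_vertex // /vertex deg_sr.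
Qed.

Lemma SGL_rel_sub E F : SGL_carrier E -> SGL_carrier F ->
  (forall p q, SGL_rel E p q <-> SGL_rel F p q) -> E `<=` F.
Proof.
move=> cE cF EF [[m g] n] Em.
have /EF[x [h [y [e [Fy ye /= ne me ge]]]]] := SGL_relP cE Em.
have /EF[m' [g' [n' [e' [En' n'e' /= ye' _ _]]]]] := SGL_relP cF Fy.
have e'e : sr e' = rg e by rewrite -ye ye' sr_ccomp.
have n'e'e : sr n' = rg (e' ** e) by rewrite rg_ccomp.
have nE : n ** sr n = n' ** (e' ** e) by rewrite ccomp_sr ccompA // -ye'.
have [? ? ?] := SGL_src_ext cE Em En' (esym (rg_sr n)) n'e'e nE; subst m' g' n'.
have E1 := ccompI (esym (rg_sr n)) n'e'e nE.
have ve : vertex e.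
  apply/ffunP => i; have /(congr1 (fun x => deg x i)) := E1.
  rewrite deg_comp // deg_sr !ffunE => /esym/eqP.
  by rewrite [X in X == _]/(_ + _)%N addn_eq0 => /andP[_ /eqP].
have re : e = sr y by rewrite ye; apply/esym/vertexP.
move: ne me ge; rewrite mulg1 ss_cocycle_vertex // re ccomp_sr => -> + ->.
by case: (cF) => _ /(_ _ _ _ Fy) <- _; rewrite ccomp_sr => ->.
Qed.

Lemma SGL_rel_eq E F : SGL_carrier E -> SGL_carrier F ->
  (forall p q, SGL_rel E p q <-> SGL_rel F p q) -> E = F.
Proof.
move=> cE cF EF; apply/seteqP; split; apply: SGL_rel_sub => // p q.
exact: iff_sym.
Qed.

Lemma SGL_star_mul E F :
  SGL_star (SGL_mul E F) `<=` SGL_mul (SGL_star F) (SGL_star E).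
Proof.
move=> [[u c] v] [m [g [n [x [h [y [a [b [Em Fx [/= na xb e de] [/= -> ec ->]]]]]]]]]].
exists y, h^-1, x, n, g^-1, m, b, a; split.
- by rewrite -SGL_starP.
- by rewrite -SGL_starP.
- split => //=; rewrite -e de; apply/ffunP => i; by rewrite !ffunE maxnC.
- congr (_, _, _); last by rewrite invgK.
  rewrite invgK phiV -[c]invgK ec invgM; congr (_ * _).
  by rewrite -phiV actKV.
Qed.

Lemma SGL_mul_src E F s t a b : SGL_carrier E -> SGL_carrier F ->
  SGL_mul E F s -> SGL_mul E F t ->
  sr s.2 = rg a -> sr t.2 = rg b -> s.2 ** a = t.2 ** b -> s = t.
Proof.
move=> cE cF [m [g [n [x [h [y [u [v [Em Fx [/= nu xv e de] ->]]]]]]]]].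
move=> [m' [g' [n' [x' [h' [y' [u' [v' [Em' Fx' [/= nu' xv' e' de'] ->]]]]]]]]] /=.
have yv : sr y = rg (act h^-1 v).
  by case: (cF) => _ /(_ _ _ _ Fx) E1 _; rewrite ss_act_rg -xv E1 actK.
have yv' : sr y' = rg (act h'^-1 v').
  by case: (cF) => _ /(_ _ _ _ Fx') E1 _; rewrite ss_act_rg -xv' E1 actK.
rewrite !sr_ccomp // => va vb.
rewrite -!ccompA // => E1.
have yva : sr y = rg (act h^-1 v ** a) by rewrite rg_ccomp.
have yvb : sr y' = rg (act h'^-1 v' ** b) by rewrite rg_ccomp.
have [? ? ?] := SGL_src_ext cF Fx Fx' yva yvb E1; subst x' h' y'.
have /(congr1 (act h)) := ccompI yva yvb E1.
rewrite !ss_act_comp // !actKV => E2.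
set a1 := act _ a in E2; set b1 := act _ b in E2.
have va1 : sr v = rg a1 by have := ss_act_sr A h va; rewrite actKV.
have vb1 : sr v' = rg b1 by have := ss_act_sr A h vb; rewrite actKV.
have E3 : (x ** v) ** a1 = (x ** v') ** b1 by rewrite -!ccompA // E2.
have ua1 : sr u = rg a1 by rewrite -va1 -(sr_ccomp _ _ nu) e sr_ccomp.
have ub1 : sr u' = rg b1 by rewrite -vb1 -(sr_ccomp _ _ nu') e' sr_ccomp.
have E4 : n ** (u ** a1) = n' ** (u' ** b1) by rewrite !ccompA // e e'.
have nua : sr n = rg (u ** a1) by rewrite rg_ccomp.
have nub : sr n' = rg (u' ** b1) by rewrite rg_ccomp.
have [? ? ?] := SGL_src_ext cE Em Em' nua nub E4; subst m' g' n'.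
have [E5 _] : x ** v = x ** v' /\ a1 = b1.
  by apply: ufact => //; rewrite ?sr_ccomp // -e -e' de de'.
have ? := ccompI xv xv' E5; subst v'.
by have -> : u = u' by apply: (ccompI nu nu'); rewrite e e'.
Qed.

Lemma SGL_mul_rng E F s t a b : SGL_carrier E -> SGL_carrier F ->
  SGL_mul E F s -> SGL_mul E F t ->
  sr s.1.1 = rg a -> sr t.1.1 = rg b -> s.1.1 ** a = t.1.1 ** b -> s = t.
Proof.
move: s t => [[m g] n] [[m' g'] n'] cE cF.
move=> /SGL_starP/SGL_star_mul h /SGL_starP/SGL_star_mul h' ma mb e.
have [-> /invg_inj -> ->] := SGL_mul_src (SGL_star_closed cF)
  (SGL_star_closed cE) h h' ma mb e.
by [].
Qed.

Lemma SGL_mul_closed E F : SGL_carrier E -> SGL_carrier F ->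
  SGL_carrier (SGL_mul E F).
Proof.
move=> cE cF; have [fE sE oE] := cE; have [fF sF oF] := cF; split.
- pose f (p : (L * G * L) * (L * G * L)) (ab : L * L) : L * G * L :=
    (p.1.1.1 ** act p.1.1.2 ab.1,
     phi p.1.1.2 ab.1 * phi p.2.1.2 (act p.2.1.2^-1 ab.2),
     p.2.2 ** act p.2.1.2^-1 ab.2).
  apply: (@sub_finite_set _ _
    (\bigcup_(p in E `*` F) f p @` Lmin p.1.2 p.2.1.1)).
    move=> _ [m [g [n [x [h [y [a [b [Em Fx ab ->]]]]]]]]].
    by exists ((m, g, n), (x, h, y)) => //; exists (a, b).
  apply: bigcup_finite; first exact: finite_setX.
  by move=> p _; apply: finite_image; exact: (ss_aligned A).
- move=> _ _ _ [m [g [n [x [h [y [a [b [Em Fx [/= na xb e de] [-> -> ->]]]]]]]]]].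
  have yb : sr y = rg (act h^-1 b) by rewrite ss_act_rg -xb (sF _ _ _ Fx) actK.
  have ma : sr m = rg (act g a) by rewrite (sE _ _ _ Em) na ss_act_rg.
  rewrite !sr_ccomp // ss_actM -(act_phi_sr h) -ss_act_srE actKV ss_act_srE.
  by rewrite act_phi_sr -(sr_ccomp _ _ na) e sr_ccomp.
- move=> s t hs ht st; split; apply/eqP; apply: contrapT => /negP/set0P[[a b]].
    by move=> [/= sa tb e _]; apply: st; exact: (SGL_mul_rng cE cF hs ht sa tb e).
  by move=> [/= sa tb e _]; apply: st; exact: (SGL_mul_src cE cF hs ht sa tb e).
Qed.

Lemma SGL_rel_mul_sub E F p r : SGL_carrier E -> SGL_carrier F ->
  SGL_rel (SGL_mul E F) p r -> exists2 q, SGL_rel F p q & SGL_rel E q r.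
Proof.
move=> [_ sE _] [_ sF _].
move=> [_ [_ [_ [z [[m [g [n [x [h [y [a [b [Em Fx [/= na xb e de] [-> -> ->]]]]]]]]]]]]]]].
have yb : sr y = rg (act h^-1 b) by rewrite ss_act_rg -xb (sF _ _ _ Fx) actK.
have ma : sr m = rg (act g a) by rewrite (sE _ _ _ Em) na ss_act_rg.
rewrite sr_ccomp // => bz; rewrite -ccompA // => pE rE r2.
set z' := act (phi h (act h^-1 b)) z.
have bz' : sr b = rg z' by have := ss_act_sr A h bz; rewrite actKV.
have az' : sr a = rg z' by rewrite -bz' -(sr_ccomp _ _ na) e sr_ccomp.
have hE : act h (act h^-1 b ** z) = b ** z' by rewrite ss_act_comp // actKV.
exists (x ** (b ** z'), phi h (act h^-1 b ** z) * p.2).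
  exists x, h, y, (act h^-1 b ** z); split => //=; first by rewrite rg_ccomp.
  by rewrite hE.
exists m, g, n, (a ** z'); split => //=.
- by rewrite rg_ccomp.
- by rewrite !ccompA // e.
- rewrite rE ss_act_comp // ss_actM -ccompA //.
  by have := ss_act_sr A g az'.
- rewrite r2 ss_cocycleM -/z' ss_cocycle_comp // ss_cocycle_comp //.
  by rewrite mulgA.
Qed.

Lemma SGL_rel_mul E F p r : SGL_carrier E -> SGL_carrier F ->
  SGL_rel (SGL_mul E F) p r <-> exists2 q, SGL_rel F p q & SGL_rel E q r.
Proof.
move=> cE cF; split; first exact: SGL_rel_mul_sub.
move=> [q pq qr].
suff [r' pr'] : exists r', SGL_rel (SGL_mul E F) p r'.
  have [q' pq' q'r'] := SGL_rel_mul_sub cE cF pr'.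
  rewrite -(SGL_rel_fun cF pq pq') in q'r'.
  by rewrite (SGL_rel_fun cE qr q'r').
have [_ sE _] := cE; have [_ sF _] := cF.
move: pq qr => [x [h [y [c [Fx yc pE qE q2]]]]] [m [g [n [w [Em nw qE' _ _]]]]].
have xhc : sr x = rg (act h c) by rewrite (sF _ _ _ Fx) yc ss_act_rg.
have E1 : n ** w = x ** act h c by rewrite -qE -qE'.
have [[a b] [z [nab az bz _ hcE]]] := Lmin_ext nw xhc E1.
have [/= na xb e _] := nab.
have bz' : sr (act h^-1 b) = rg (act (phi h^-1 b) z) by exact: ss_act_sr.
have cE' : c = act h^-1 b ** act (phi h^-1 b) z.
  by rewrite -ss_act_comp // -hcE actK.
have yb : sr y = rg (act h^-1 b) by rewrite ss_act_rg -xb (sF _ _ _ Fx) actK.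
pose t := (m ** act g a, phi g a * phi h (act h^-1 b), y ** act h^-1 b).
exists (t.1.1 ** act t.1.2 (act (phi h^-1 b) z),
  phi t.1.2 (act (phi h^-1 b) z) * p.2).
exists t.1.1, t.1.2, t.2, (act (phi h^-1 b) z); split => //.
- by exists m, g, n, x, h, y, a, b; split.
- by rewrite /t /= sr_ccomp.
- by rewrite /t /= -ccompA // -cE'.
Qed.

HB.instance Definition _ := Choice.on SGL.

Implicit Types s t : SGL.

Definition sgl_mul s t : SGL :=
  SigSub (mem_set (SGL_mul_closed (set_valP s) (set_valP t))).
Definition sgl_star s : SGL := SigSub (mem_set (SGL_star_closed (set_valP s))).

Lemma SGL_carrier0 : SGL_carrier set0.
Proof. by split => //; exact: finite_set0. Qed.

Definition sgl_zero : SGL := SigSub (mem_set SGL_carrier0).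

Definition sgl_rel s := SGL_rel (val s).

Lemma sgl_rel_eq s t : (forall p q, sgl_rel s p q <-> sgl_rel t p q) -> s = t.
Proof.
by move=> h; apply: val_inj; apply: SGL_rel_eq => //; exact: set_valP.
Qed.

Lemma sgl_rel_mul s t p r :
  sgl_rel (sgl_mul s t) p r <-> exists2 q, sgl_rel t p q & sgl_rel s q r.
Proof. by apply: SGL_rel_mul; exact: set_valP. Qed.

Lemma sgl_rel_star s p q : sgl_rel (sgl_star s) p q <-> sgl_rel s q p.
Proof.
split=> [|]; last exact/SGL_rel_star/set_valP.
by move=> /(SGL_rel_star (set_valP (sgl_star s))); rewrite /= SGL_starK.
Qed.

Lemma sgl_rel_fun s p q q' : sgl_rel s p q -> sgl_rel s p q' -> q = q'.
Proof. exact/SGL_rel_fun/set_valP. Qed.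

Lemma sgl_rel_inj s p p' q : sgl_rel s p q -> sgl_rel s p' q -> p = p'.
Proof. exact/SGL_rel_inj/set_valP. Qed.

Lemma sgl_mulA : associative sgl_mul.
Proof.
move=> s t u; apply: sgl_rel_eq => p q; rewrite !sgl_rel_mul; split.
  move=> [x /sgl_rel_mul[y py yx] xq]; exists y => //.
  by apply/sgl_rel_mul; exists x.
move=> [x px /sgl_rel_mul[y xy yq]]; exists y => //.
by apply/sgl_rel_mul; exists x.
Qed.

Lemma sgl_mulsKs s : sgl_mul (sgl_mul s (sgl_star s)) s = s.
Proof.
apply: sgl_rel_eq => p q; rewrite sgl_rel_mul; split.
  move=> [x px /sgl_rel_mul[y /sgl_rel_star yx yq]].
  by rewrite (sgl_rel_inj px yx).
move=> pq; exists q => //; apply/sgl_rel_mul; exists p => //.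
exact/sgl_rel_star.
Qed.

Lemma sgl_starK s : sgl_star (sgl_star s) = s.
Proof. by apply: sgl_rel_eq => p q; rewrite !sgl_rel_star. Qed.

Lemma sgl_starKs s : sgl_mul (sgl_mul (sgl_star s) s) (sgl_star s) = sgl_star s.
Proof. by have := sgl_mulsKs (sgl_star s); rewrite sgl_starK. Qed.

Lemma sgl_star_unique s t : sgl_mul (sgl_mul s t) s = s ->
  sgl_mul (sgl_mul t s) t = t -> t = sgl_star s.
Proof.
have key u v p q : sgl_mul (sgl_mul u v) u = u -> sgl_rel u p q -> sgl_rel v q p.
  move=> e pq; move: (pq); rewrite -e => /sgl_rel_mul[x px].
  move=> /sgl_rel_mul[y xy yq].
  by rewrite (sgl_rel_fun pq px) (sgl_rel_inj pq yq).
move=> e1 e2; apply: sgl_rel_eq => p q; rewrite sgl_rel_star.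
by split; exact: key.
Qed.

Lemma sgl_mul0s s : sgl_mul sgl_zero s = sgl_zero.
Proof.
apply: sgl_rel_eq => p q; rewrite sgl_rel_mul; split.
  by move=> [x _ [? [? [? [? []]]]]].
by move=> [? [? [? [? []]]]].
Qed.

Lemma sgl_muls0 s : sgl_mul s sgl_zero = sgl_zero.
Proof.
apply: sgl_rel_eq => p q; rewrite sgl_rel_mul; split.
  by move=> [x [? [? [? [? []]]]]].
by move=> [? [? [? [? []]]]].
Qed.

HB.instance Definition _ := isSemigroup.Build SGL sgl_mulA.
HB.instance Definition _ := Semigroup_isInvSemigroup0.Build SGL
  sgl_mulsKs sgl_starKs sgl_star_unique sgl_mul0s sgl_muls0.

End SelfSimilarTheory.

Section InvSemigroupTheory.
Context {S : invSemigroup0Type}.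
Implicit Types e f s t u : S.

Definition idem e := e * e = e.

Definition ile e f := e * f = e.

Lemma starK s : s^*^* = s.
Proof. by apply/esym/star_unique; rewrite ?starKs ?mulsKs. Qed.

Lemma star_idem e : idem e -> e^* = e.
Proof. by move=> ee; apply/esym/star_unique; rewrite !ee. Qed.

Lemma idem_mul e f : idem e -> idem f -> idem (e * f).
Proof.
move=> ee ff; set x := (e * f)^*.
have x1 : e * f * x * (e * f) = e * f by exact: mulsKs.
have x2 : x * (e * f) * x = x by exact: starKs.
have fxe : f * x * e = x.
  apply: star_unique.
    transitivity (e * (f * f) * x * ((e * e) * f)); first by rewrite !mulgA.
    by rewrite ff ee.
  transitivity (f * (x * ((e * e) * (f * f)) * x) * e); first by rewrite !mulgA.
  by rewrite ff ee x2.
have xx : idem x.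
  rewrite /idem -{1 2}fxe.
  transitivity (f * (x * (e * f) * x) * e); first by rewrite !mulgA.
  by rewrite x2 fxe.
have <- : x = e * f by rewrite -(starK (e * f)) -/x star_idem.
exact: xx.
Qed.

Lemma idemC e f : idem e -> idem f -> e * f = f * e.
Proof.
move=> ee ff; have ef := idem_mul ee ff; have fe := idem_mul ff ee.
rewrite -{1}(star_idem ef); apply/esym/star_unique.
  transitivity ((e * (f * f)) * ((e * e) * f)); first by rewrite !mulgA.
  by rewrite ff ee.
transitivity ((f * (e * e)) * ((f * f) * e)); first by rewrite !mulgA.
by rewrite ff ee.
Qed.

Lemma idem_ss s : idem (s^* * s).
Proof. by rewrite /idem mulgA starKs. Qed.

Lemma idem_ss' s : idem (s * s^*).
Proof. by rewrite /idem mulgA mulsKs. Qed.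

Lemma starM s t : (s * t)^* = t^* * s^*.
Proof.
have c := idemC (idem_ss s) (idem_ss' t).
apply/esym/star_unique.
  transitivity (s * ((t * t^*) * (s^* * s)) * t); first by rewrite !mulgA.
  by rewrite -c !mulgA mulsKs -!mulgA (mulgA t) mulsKs.
transitivity (t^* * ((s^* * s) * (t * t^*)) * s^*); first by rewrite !mulgA.
by rewrite c !mulgA starKs -!mulgA (mulgA s^*) starKs.
Qed.

Lemma idem_conj s e : idem e -> idem (s^* * e * s).
Proof.
move=> ee; rewrite /idem.
transitivity (s^* * (e * (s * s^*) * e) * s); first by rewrite !mulgA.
by rewrite (idemC ee (idem_ss' s)) -(mulgA (s * s^*)) ee !mulgA starKs.
Qed.

Lemma idem_conj' s e : idem e -> idem (s * e * s^*).
Proof. by move=> ee; have := idem_conj s^* ee; rewrite starK. Qed.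

Lemma ileMl e f : idem e -> idem f -> ile (e * f) e.
Proof. by move=> ee ff; rewrite /ile (idemC ee ff) -mulgA ee. Qed.

Lemma ileMr e f : idem f -> ile (e * f) f.
Proof. by move=> ff; rewrite /ile -mulgA ff. Qed.

(* Filters in E(S) not containing 0. *)
Definition filters0 : set (set S) :=
  [set F | [/\ F !=set0, F `<=` idem,
    forall e f, F e -> F f -> F (e * f),
    forall e f, F e -> idem f -> ile e f -> F f & ~ F szero]].

End InvSemigroupTheory.

Definition Ehat0 (S : invSemigroup0Type) : Type := set_type (@filters0 S).
HB.instance Definition _ (S : invSemigroup0Type) := Choice.on (Ehat0 S).
Definition filter_set (S : invSemigroup0Type) (F : Ehat0 S) : set S := val F.
Arguments filter_set {S} F.

Definition Ehat0_basic (S : invSemigroup0Type) (e : S) (es : seq S) :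
    set (Ehat0 S) :=
  [set F | filter_set F e /\ forall f, f \in es -> ~ filter_set F f].

HB.instance Definition _ (S : invSemigroup0Type) :=
  isSubBaseTopological.Build (Ehat0 S)
    [set U | exists e es, [/\ idem e, forall f, f \in es -> idem f
      & U = @Ehat0_basic S e es]] id.

Definition ultrafilters (S : invSemigroup0Type) : set (Ehat0 S) :=
  [set F | forall H : Ehat0 S, filter_set F `<=` filter_set H -> F = H].

Definition Etight (S : invSemigroup0Type) : Type :=
  set_type (closure (@ultrafilters S)).
HB.instance Definition _ (S : invSemigroup0Type) := Topological.on (Etight S).
Definition tight_set (S : invSemigroup0Type) (F : Etight S) : set S :=
  filter_set (val F).
Arguments tight_set {S} F.

Section Theta.
Context {S : invSemigroup0Type}.
Implicit Types (s t e f : S) (F : Etight S).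

Definition theta_dom s : set (Etight S) := [set F | tight_set F (s^* * s)].

Definition theta_set s (F : set S) : set S :=
  [set f | idem f /\ exists2 e, F e & ile (s * e * s^*) f].

(* The default value F is not used on [theta_dom s] ([theta_setE] below). *)
Definition theta s F : Etight S :=
  xget F [set H | tight_set H = theta_set s (tight_set F)].

Lemma filters0P (F : Ehat0 S) : filters0 (filter_set F).
Proof. exact: (set_valP (F : set_type _)). Qed.

Lemma filter_set_inj : injective (@filter_set S).
Proof. by move=> F H /val_inj. Qed.

Lemma tight_set_inj : injective (@tight_set S).
Proof. by move=> F H /filter_set_inj/val_inj. Qed.

Lemma tightP F : filters0 (tight_set F).
Proof. exact: filters0P. Qed.

Lemma theta_setP s (F : set S) e : filters0 F -> F (s^* * s) ->
  theta_set s F e <-> idem e /\ F (s^* * e * s).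
Proof.
move=> [_ FE FM FU _] Fs; split=> -[ee].
  move=> [f Ff fe]; split => //.
  have fi := FE _ Ff; have si := idem_ss s.
  apply: (FU (f * (s^* * s))); [exact: FM|exact: idem_conj|].
  have fE : f * (s^* * s) = s^* * (s * f * s^*) * s.
    transitivity ((s^* * s) * f * (s^* * s)); last by rewrite !mulgA.
    by rewrite -(idemC fi si) -[RHS]mulgA si.
  rewrite /ile [in RHS]fE -[in RHS]fe fE.
  transitivity (s^* * (s * f * (s^* * s * s^*) * e) * s); first by rewrite !mulgA.
  by rewrite starKs.
move=> Fe; split => //; exists (s^* * e * s) => //.
have -> : s * (s^* * e * s) * s^* = s * s^* * e.
  transitivity ((s * s^*) * (e * (s * s^*))); first by rewrite !mulgA.
  by rewrite (idemC ee (idem_ss' s)) mulgA idem_ss'.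
by rewrite /ile -mulgA ee.
Qed.

Lemma theta_filters0 s (F : set S) : filters0 F -> F (s^* * s) ->
  filters0 (theta_set s F).
Proof.
move=> cF Fs; have [_ FE FM FU F0] := cF.
split.
- exists (s * s^*); apply/(theta_setP _ cF Fs); split; first exact: idem_ss'.
  by rewrite !mulgA starKs.
- by move=> e [].
- move=> e f /(theta_setP _ cF Fs)[ee Fe] /(theta_setP _ cF Fs)[ff Ff].
  apply/(theta_setP _ cF Fs); split; first exact: idem_mul.
  have -> : s^* * (e * f) * s = (s^* * e * s) * (s^* * f * s).
    transitivity (s^* * (e * (s * s^*)) * f * s); last by rewrite !mulgA.
    by rewrite (idemC ee (idem_ss' s)) !mulgA starKs.
  exact: FM.
- move=> e f /(theta_setP _ cF Fs)[ee Fe] ff ef.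
  apply/(theta_setP _ cF Fs); split => //; apply: (FU _ _ Fe).
    exact: idem_conj.
  rewrite /ile.
  transitivity (s^* * (e * (s * s^*) * f) * s); first by rewrite !mulgA.
  rewrite (idemC ee (idem_ss' s)) -(mulgA _ e) ef !mulgA starKs //.
- by move=> /(theta_setP _ cF Fs)[_]; rewrite muls0 mul0s.
Qed.

Lemma theta_set_ss s (F : set S) : filters0 F -> F (s^* * s) ->
  theta_set s F (s * s^*).
Proof.
move=> cF Fs; apply/theta_setP => //; split; first exact: idem_ss'.
by rewrite !mulgA starKs.
Qed.

Lemma theta_setM s t (F : set S) : filters0 F -> F (s^* * s) ->
  theta_set s F (t^* * t) -> theta_set t (theta_set s F) = theta_set (t * s) F.
Proof.
move=> cF Fs Ft; have cH := theta_filters0 cF Fs.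
have Fts : F ((t * s)^* * (t * s)).
  by have /(theta_setP _ cF Fs)[_] := Ft; rewrite starM !mulgA.
apply/seteqP; split => e.
  move=> /(theta_setP _ cH Ft)[ee /(theta_setP _ cF Fs)[_ Fe]].
  by apply/(theta_setP _ cF Fts); rewrite starM !mulgA in Fe *.
move=> /(theta_setP _ cF Fts)[ee Fe].
apply/(theta_setP _ cH Ft); split => //; apply/(theta_setP _ cF Fs).
by split; [exact: idem_conj|rewrite starM !mulgA in Fe *].
Qed.

Lemma theta_set_idem e (F : set S) : filters0 F -> idem e -> F e ->
  theta_set e F = F.
Proof.
move=> cF ee Fe; have [_ FE FM FU _] := cF.
have Fee : F (e^* * e) by rewrite star_idem // ee.
apply/seteqP; split => f.
  move=> /(theta_setP _ cF Fee)[ff]; rewrite star_idem // => Fefe.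
  apply: (FU _ _ Fefe) => //.
  by rewrite -mulgA -(idemC ee ff) mulgA ee; exact: ileMr.
move=> Ff; apply/(theta_setP _ cF Fee); split; first exact: FE.
by rewrite star_idem //; apply: (FM _ _ _ Fe); exact: (FM _ _ Fe).
Qed.

Lemma theta_setK s (F : set S) : filters0 F -> F (s^* * s) ->
  theta_set s^* (theta_set s F) = F.
Proof.
move=> cF Fs; rewrite theta_setM //; last by rewrite starK; exact: theta_set_ss.
by rewrite theta_set_idem //; exact: idem_ss.
Qed.

Lemma theta_set_mono s (F H : set S) : F `<=` H ->
  theta_set s F `<=` theta_set s H.
Proof. by move=> FH e [ee [f Ff fe]]; split => //; exists f => //; exact: FH. Qed.

Lemma theta_ultra s (F H : Ehat0 S) : ultrafilters F ->
  filter_set F (s^* * s) -> filter_set H = theta_set s (filter_set F) ->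
  ultrafilters H.
Proof.
move=> uF Fs HE K HK; apply: filter_set_inj.
have cF := filters0P F; have cK := filters0P K.
have Kss : filter_set K (s^*^* * s^*).
  by rewrite starK; apply: HK; rewrite HE; exact: theta_set_ss.
pose F' : Ehat0 S := SigSub (mem_set (theta_filters0 cK Kss)).
have FF' : F = F'.
  apply: uF; rewrite -(theta_setK cF Fs) -HE.
  exact: theta_set_mono.
have := theta_setK cK Kss; rewrite starK => <-.
by rewrite HE FF'.
Qed.

Lemma open_Ehat0_basic e es : idem e -> (forall f, f \in es -> idem f) ->
  open (@Ehat0_basic S e es).
Proof.
move=> ee ff; exists [set Ehat0_basic e es]; last by rewrite bigcup_set1.
move=> _ ->; exists [fset Ehat0_basic e es]%fset.
  by move=> x /fset1P ->; apply/mem_set; exists e, es.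
apply/seteqP; split => [x h|x hx y /fset1P -> //].
exact: (h (Ehat0_basic e es) (fset11 _)).
Qed.

Lemma theta_set_cvg s (F H : Ehat0 S) (B : set (Ehat0 S)) :
  filter_set F (s^* * s) -> filter_set H = theta_set s (filter_set F) ->
  nbhs H B -> nbhs F [set F' | filter_set F' (s^* * s) /\
    forall H', filter_set H' = theta_set s (filter_set F') -> B H'].
Proof.
move=> Fs HE; rewrite nbhsE => -[O [oO OH] OB].
move: oO => [D' D'sub OE]; move: OH; rewrite -OE => -[A D'A AH].
have Dss : nbhs F (Ehat0_basic (s^* * s) [::]).
  by apply: open_nbhs_nbhs; split; [apply: open_Ehat0_basic => //; exact: idem_ss|].
have [X Xsub XA] := D'sub _ D'A.
have key i : i \in X -> nbhs F [set F' | filter_set F' (s^* * s) /\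
    forall H', filter_set H' = theta_set s (filter_set F') -> i H'].
  move=> iX; have [e [es [ee ff iE]]] := set_mem (Xsub i iX).
  have iH : i H by move: AH; rewrite -XA; apply.
  move: iH; rewrite iE => -[He Hes].
  have bF : Ehat0_basic (s^* * e * s) [seq s^* * f * s | f <- es] F.
    split; first by move: He; rewrite HE => /(theta_setP _ (filters0P _) Fs)[].
    move=> _ /mapP[f fes ->] Ff; apply: (Hes f fes); rewrite HE.
    by apply/theta_setP => //; [exact: filters0P|split => //; exact: ff].
  have nb : nbhs F (Ehat0_basic (s^* * e * s) [seq s^* * f * s | f <- es]).
    apply: open_nbhs_nbhs; split => //; apply: open_Ehat0_basic.
      exact: idem_conj.
    by move=> _ /mapP[f /ff fi ->]; exact: idem_conj.
  apply: filterS (filterI Dss nb) => F' [[F's _] [F'e F'es]]; split => // H' H'E.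
  split; first by rewrite H'E; apply/theta_setP => //; exact: filters0P.
  move=> f fes; rewrite H'E => /(theta_setP _ (filters0P _) F's)[_].
  by apply: F'es; exact: map_f.
apply: filterS (filterI Dss (@filter_bigI _ _ _ _ _ _ key)) => F' [[F's _] h].
split => // H' H'E; apply: OB; rewrite -OE.
have AH' : (A : set (Ehat0 S)) H' by rewrite -XA => i iX; exact: (h i iX).2.
by exists A.
Qed.

Lemma theta_tight s (F H : Ehat0 S) : closure (@ultrafilters S) F ->
  filter_set F (s^* * s) -> filter_set H = theta_set s (filter_set F) ->
  closure (@ultrafilters S) H.
Proof.
move=> tF Fs HE B /(theta_set_cvg Fs HE)/tF[F' [uF' [F's h]]].
pose H' : Ehat0 S := SigSub (mem_set (theta_filters0 (filters0P F') F's)).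
by exists H'; split; [exact: (theta_ultra uF' F's)|exact: h].
Qed.

Lemma theta_setE s F : theta_dom s F ->
  tight_set (theta s F) = theta_set s (tight_set F).
Proof.
move=> Fs; rewrite /theta; case: xgetP => [H _ //|/(_ _) noH].
pose H : Ehat0 S := SigSub (mem_set (theta_filters0 (tightP F) Fs)).
have tH : closure (@ultrafilters S) H.
  exact: (theta_tight (set_valP (F : set_type _)) Fs).
by case: (noH (SigSub (mem_set tH) : Etight S)).
Qed.

Lemma theta_ss s F : theta_dom s F -> tight_set (theta s F) (s * s^*).
Proof. by move=> Fs; rewrite theta_setE //; apply: theta_set_ss => //; exact: tightP. Qed.

Lemma theta_dom_star s F : theta_dom s F -> theta_dom s^* (theta s F).
Proof. by move=> /theta_ss; rewrite /theta_dom /= starK. Qed.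

Lemma theta_domM s t F : theta_dom s F ->
  theta_dom (t * s) F <-> theta_dom t (theta s F).
Proof.
move=> Fs; rewrite /theta_dom /= theta_setE // starM; split.
  by move=> h; apply/theta_setP => //; [exact: tightP|split; [exact: idem_ss|rewrite !mulgA in h *]].
by move=> /(theta_setP _ (tightP F) Fs)[_]; rewrite !mulgA.
Qed.

Lemma thetaM s t F : theta_dom s F -> theta_dom t (theta s F) ->
  theta t (theta s F) = theta (t * s) F.
Proof.
move=> Fs Ft; apply: tight_set_inj.
rewrite !theta_setE //; last exact/theta_domM.
rewrite theta_setM //; first exact: tightP.
by rewrite -theta_setE.
Qed.

Lemma theta_idem e F : idem e -> tight_set F e -> theta e F = F.
Proof.
move=> ee Fe; have Fee : theta_dom e F by rewrite /theta_dom /= star_idem // ee.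
by apply: tight_set_inj; rewrite theta_setE // theta_set_idem //; exact: tightP.
Qed.

Lemma thetaK s F : theta_dom s F -> theta s^* (theta s F) = F.
Proof.
move=> Fs; apply: tight_set_inj; rewrite theta_setE; last exact: theta_dom_star.
by rewrite theta_setE // theta_setK //; exact: tightP.
Qed.

End Theta.

Section Germs.
Context {S : invSemigroup0Type}.
Implicit Types (s t e f : S) (F H : Etight S).

Definition pregerm : Type := set_type [set p : S * Etight S | theta_dom p.1 p.2].
HB.instance Definition _ := Choice.on pregerm.

Definition same_germ (p q : pregerm) : bool :=
  `[< (val p).2 = (val q).2 /\
      exists2 e, tight_set (val p).2 e & (val p).1 * e = (val q).1 * e >].

Lemma same_germ_refl : reflexive same_germ.
Proof.
move=> p; apply/asboolP; split => //.
by exists ((val p).1^* * (val p).1) => //; exact: (set_valP (p : set_type _)).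
Qed.

Lemma same_germ_sym : symmetric same_germ.
Proof.
by move=> p q; apply/asboolP/asboolP => -[E [e]]; rewrite E => He e1; split => //;
  exists e.
Qed.

Lemma same_germ_trans : transitive same_germ.
Proof.
move=> q p r /asboolP[E1 [e pe e1]] /asboolP[E2 [f qf f1]]; apply/asboolP.
split; first by rewrite E1.
have [_ FE FM _ _] := tightP (val p).2; rewrite -E1 in qf.
exists (e * f); first exact: FM.
by rewrite mulgA e1 -mulgA (idemC (FE _ pe) (FE _ qf)) mulgA f1 -mulgA.
Qed.

Canonical same_germ_equiv :=
  EquivRel same_germ same_germ_refl same_germ_sym same_germ_trans.

End Germs.
Arguments pregerm S : clear implicits.

Local Open Scope quotient_scope.

Definition tight_groupoid (S : invSemigroup0Type) : Type :=
  {eq_quot (@same_germ_equiv S)}.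
HB.instance Definition _ (S : invSemigroup0Type) :=
  Choice.on (tight_groupoid S).
HB.instance Definition _ (S : invSemigroup0Type) :=
  EqQuotient.on (tight_groupoid S).

Section TightGroupoid.
Context {S : invSemigroup0Type}.
Implicit Types (s t e f : S) (F H : Etight S) (x y z : tight_groupoid S).

Definition germ s F (sF : theta_dom s F) : tight_groupoid S :=
  \pi_(tight_groupoid S)
    (SigSub (mem_set (sF : [set p : S * Etight S | theta_dom p.1 p.2] (s, F)))).

Definition germ_el x : S := (val (repr x)).1.
Definition germ_src x : Etight S := (val (repr x)).2.

Lemma germ_dom x : theta_dom (germ_el x) (germ_src x).
Proof. exact: (set_valP (repr x : set_type _)). Qed.

Lemma germ_elK x : germ (@germ_dom x) = x.
Proof.
rewrite -[RHS]reprK /germ; congr (\pi _); apply: val_inj.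
by rewrite /= /germ_el /germ_src -surjective_pairing.
Qed.

Lemma germP x : exists s F (sF : theta_dom s F), x = germ sF.
Proof. by exists (germ_el x), (germ_src x), (@germ_dom x); rewrite germ_elK. Qed.

Lemma germ_eqP s t F H (sF : theta_dom s F) (tH : theta_dom t H) :
  germ sF = germ tH <-> F = H /\ exists2 e, tight_set F e & s * e = t * e.
Proof. by split=> [/eqmodP/asboolP //|h]; apply/eqmodP/asboolP. Qed.

Lemma theta_dom_src s F : theta_dom s F -> theta_dom (s^* * s) F.
Proof.
by move=> sF; rewrite /theta_dom /= star_idem ?idem_ss //; exact: idem_ss.
Qed.

Lemma theta_dom_rng s F : theta_dom s F -> theta_dom (s * s^*) (theta s F).
Proof.
move=> sF; rewrite /theta_dom /= star_idem ?idem_ss' //; last exact: idem_ss'.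
exact: theta_ss.
Qed.

Definition tight_src x : tight_groupoid S := germ (theta_dom_src (@germ_dom x)).

Definition tight_rng x : tight_groupoid S := germ (theta_dom_rng (@germ_dom x)).

Definition tight_inv x : tight_groupoid S := germ (theta_dom_star (@germ_dom x)).

(* The second branch is not used on composable pairs ([tight_comp_germ]). *)
Definition tight_comp x y : tight_groupoid S :=
  if pselect (theta_dom (germ_el x * germ_el y) (germ_src y)) is left xy
  then germ xy else y.

Lemma germ_elP s F (sF : theta_dom s F) : germ_src (germ sF) = F /\
  exists2 e, tight_set F e & germ_el (germ sF) * e = s * e.
Proof.
have := germ_elK (germ sF); move: (@germ_dom (germ sF)).
move: (germ_el _) (germ_src _) => t H tH /germ_eqP[E [e He e1]].
by split => //; exists e => //; rewrite -E.
Qed.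

Lemma theta_same_germ s t F e : theta_dom s F -> theta_dom t F ->
  tight_set F e -> s * e = t * e -> theta s F = theta t F.
Proof.
move=> sF tF Fe E; apply: tight_set_inj; rewrite !theta_setE //.
have [_ FE FM _ _] := tightP F.
have sub u v : u * e = v * e ->
    theta_set u (tight_set F) `<=` theta_set v (tight_set F).
  move=> uv f [ff [g Fg gf]]; split => //; exists (e * g); first exact: FM.
  have ei := FE _ Fe; have gi := FE _ Fg.
  have key w : w * (e * g) * w^* = (w * e) * g * (w * e)^*.
    rewrite starM (star_idem ei).
    transitivity (w * (e * (g * e)) * w^*); last by rewrite !mulgA.
    by rewrite -(idemC ei gi) (mulgA e e g) ei.
  rewrite key -uv -key /ile.
  have -> : u * (e * g) * u^* = u * e * u^* * (u * g * u^*).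
    transitivity (u * (e * (u^* * u)) * g * u^*); last by rewrite !mulgA.
    by rewrite (idemC ei (idem_ss u)) !mulgA mulsKs.
  by rewrite -mulgA gf.
by apply/seteqP; split; apply: sub.
Qed.

Lemma germ_idem e f F H (eF : theta_dom e F) (fH : theta_dom f H) :
  idem e -> idem f -> F = H -> germ eF = germ fH.
Proof.
move=> ee ff E; subst H; apply/germ_eqP; split => //.
have [_ _ FM _ _] := tightP F.
exists (e * f).
  by apply: FM; [move: eF|move: fH]; rewrite /theta_dom /= star_idem // ?ee ?ff.
by rewrite mulgA ee (idemC ee ff) mulgA ff.
Qed.

Lemma germ_congr s t F H (sF : theta_dom s F) (tH : theta_dom t H) :
  s = t -> F = H -> germ sF = germ tH.
Proof. by move=> ? ?; subst; congr germ; exact: Prop_irrelevance. Qed.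

Lemma tight_src_germ s F (sF : theta_dom s F) :
  tight_src (germ sF) = germ (theta_dom_src sF).
Proof.
by apply: germ_idem; [exact: idem_ss|exact: idem_ss|exact: (germ_elP sF).1].
Qed.

Lemma theta_germ s F (sF : theta_dom s F) :
  theta (germ_el (germ sF)) (germ_src (germ sF)) = theta s F.
Proof.
have [E [e Fe e1]] := germ_elP sF.
have := @germ_dom (germ sF); rewrite E => tF.
exact: theta_same_germ Fe e1.
Qed.

Lemma tight_rng_germ s F (sF : theta_dom s F) :
  tight_rng (germ sF) = germ (theta_dom_rng sF).
Proof.
by apply: germ_idem; [exact: idem_ss'|exact: idem_ss'|exact: theta_germ].
Qed.

Lemma tight_inv_germ s F (sF : theta_dom s F) :
  tight_inv (germ sF) = germ (theta_dom_star sF).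
Proof.
apply/germ_eqP; split; first exact: theta_germ.
have [E [e Fe e1]] := germ_elP sF.
have := @germ_dom (germ sF); rewrite theta_germ E.
move: (germ_el _) e1 => t e1 tF.
have tsF : theta t F = theta s F by exact: theta_same_germ Fe e1.
have [_ FE FM _ _] := tightP F; have ei := FE _ Fe.
have c u : theta_dom u F -> theta u F = theta s F ->
    tight_set (theta s F) (u * e * u^*).
  move=> uF <-; rewrite theta_setE //; apply/theta_setP => //; first exact: tightP.
  split; first exact: idem_conj'.
  have -> : u^* * (u * e * u^*) * u = (u^* * u) * e * (u^* * u) by rewrite !mulgA.
  by apply: (FM _ _ _ uF); exact: (FM _ _ uF).
have ste : s * e * s^* = t * e * t^*.
  have k u : u * e * u^* = (u * e) * (u * e)^*.
    by rewrite starM (star_idem ei) mulgA -(mulgA u e e) ei.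
  by rewrite !k e1.
exists (s * e * s^*); first exact: c.
have k u : u^* * (u * e * u^*) = (u * e)^*.
  rewrite starM (star_idem ei) !mulgA (idemC (idem_ss u) ei).
  by rewrite -!mulgA [u^* * (u * u^*)]mulgA starKs.
by rewrite k ste k e1.
Qed.

Lemma tight_comp_germ s t F H (tH : theta_dom t H) (sF : theta_dom s F)
  (tsF : theta_dom (t * s) F) : H = theta s F ->
  tight_comp (germ tH) (germ sF) = germ tsF.
Proof.
move=> HE; rewrite /tight_comp.
have Es := germ_elP sF; have Et := germ_elP tH.
have ds := @germ_dom (germ sF); have dt := @germ_dom (germ tH).
have Eth := theta_germ sF.
move: Es Et ds dt Eth.
move: (germ_el (germ sF)) (germ_src (germ sF)) => s' F' [->] [f Ff sf].
move: (germ_el (germ tH)) (germ_src (germ tH)) => t' H' [->] [e He te].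
move=> ds dt Eth; subst H.
case: pselect => [d|]; last first.
  by case; apply/theta_domM => //; rewrite Eth.
apply/germ_eqP; split => //.
have [_ FE FM _ _] := tightP F; have [_ HE _ _ _] := tightP (theta s F).
have fi := FE _ Ff; have ei := HE _ He.
move: He; rewrite theta_setE // => /(theta_setP _ (tightP F) sF)[_ Fe].
exists ((s^* * e * s) * f); first exact: FM.
have ci : idem (s^* * e * s) by exact: idem_conj.
have E1 : s * (s^* * e * s * f) = e * s * f.
  transitivity ((s * s^*) * e * s * f); first by rewrite !mulgA.
  rewrite -(idemC ei (idem_ss' s)).
  transitivity (e * (s * s^* * s) * f); first by rewrite !mulgA.
  by rewrite mulsKs.
have E2 : s' * (s^* * e * s * f) = e * s * f.
  by rewrite (idemC ci fi) mulgA sf -mulgA -(idemC ci fi).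
by rewrite -(mulgA t') -(mulgA t) E1 E2 !mulgA te.
Qed.

Lemma tight_composable s t F H (tH : theta_dom t H) (sF : theta_dom s F) :
  tight_src (germ tH) = tight_rng (germ sF) -> H = theta s F.
Proof. by rewrite tight_src_germ tight_rng_germ => /germ_eqP[]. Qed.

Lemma tight_composableP x y : tight_src x = tight_rng y ->
  exists s t F (sF : theta_dom s F) (tH : theta_dom t (theta s F))
    (tsF : theta_dom (t * s) F),
    [/\ x = germ tH, y = germ sF & tight_comp x y = germ tsF].
Proof.
have [t [H [tH ->]]] := germP x; have [s [F [sF ->]]] := germP y.
move=> /tight_composable E; subst H.
have tsF : theta_dom (t * s) F by apply/theta_domM.
by exists s, t, F, sF, tH, tsF; split => //; exact: tight_comp_germ.
Qed.

Lemma tight_rg_rg x : tight_rng (tight_rng x) = tight_rng x.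
Proof.
have [s [F [sF ->]]] := germP x; rewrite !tight_rng_germ.
apply: germ_idem; [exact: idem_ss'|exact: idem_ss'|].
by apply: theta_idem; [exact: idem_ss'|exact: theta_ss].
Qed.

Lemma tight_rg_sr x : tight_rng (tight_src x) = tight_src x.
Proof.
have [s [F [sF ->]]] := germP x; rewrite !tight_src_germ !tight_rng_germ.
apply: germ_idem; [exact: idem_ss'|exact: idem_ss|].
by apply: theta_idem => //; exact: idem_ss.
Qed.

Lemma tight_sr_rg x : tight_src (tight_rng x) = tight_rng x.
Proof.
have [s [F [sF ->]]] := germP x; rewrite !tight_rng_germ !tight_src_germ.
by apply: germ_idem => //; [exact: idem_ss|exact: idem_ss'].
Qed.

Lemma tight_sr_sr x : tight_src (tight_src x) = tight_src x.
Proof.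
have [s [F [sF ->]]] := germP x; rewrite !tight_src_germ.
by apply: germ_idem => //; exact: idem_ss.
Qed.

Lemma tight_comp_rg x : tight_comp (tight_rng x) x = x.
Proof.
have [s [F [sF ->]]] := germP x; rewrite tight_rng_germ.
have d : theta_dom (s * s^* * s) F by rewrite mulsKs.
by rewrite (tight_comp_germ _ _ d) //; apply: germ_congr => //; rewrite mulsKs.
Qed.

Lemma tight_comp_sr x : tight_comp x (tight_src x) = x.
Proof.
have [s [F [sF ->]]] := germP x; rewrite tight_src_germ.
have d : theta_dom (s * (s^* * s)) F by rewrite mulgA mulsKs.
rewrite (tight_comp_germ _ _ d).
  by apply: germ_congr => //; rewrite mulgA mulsKs.
by rewrite theta_idem //; exact: idem_ss.
Qed.

Lemma tight_rg_comp x y : tight_src x = tight_rng y ->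
  tight_rng (tight_comp x y) = tight_rng x.
Proof.
move=> /tight_composableP[s [t [F [sF [tH [tsF [-> -> ->]]]]]]].
rewrite !tight_rng_germ; apply: germ_idem; [exact: idem_ss'|exact: idem_ss'|].
by rewrite thetaM.
Qed.

Lemma tight_sr_comp x y : tight_src x = tight_rng y ->
  tight_src (tight_comp x y) = tight_src y.
Proof.
move=> /tight_composableP[s [t [F [sF [tH [tsF [-> -> ->]]]]]]].
by rewrite !tight_src_germ; apply: germ_idem => //; exact: idem_ss.
Qed.

Lemma tight_compA x y z : tight_src x = tight_rng y -> tight_src y = tight_rng z ->
  tight_comp x (tight_comp y z) = tight_comp (tight_comp x y) z.
Proof.
move=> xy /tight_composableP[s [t [F [sF [tH [tsF [yE -> ->]]]]]]]; subst y.
move: xy.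
have [u [K [uK ->]]] := germP x => /tight_composable KE; subst K.
have utH : theta_dom (u * t) (theta s F) by apply/theta_domM.
have utsF : theta_dom (u * t * s) F by apply/theta_domM.
have utsF' : theta_dom (u * (t * s)) F by rewrite mulgA.
rewrite (tight_comp_germ _ _ utH) // (tight_comp_germ _ _ utsF) //.
rewrite (tight_comp_germ _ _ utsF') ?thetaM //.
by apply: germ_congr => //; rewrite mulgA.
Qed.

HB.instance Definition _ := isCategory.Build (tight_groupoid S)
  tight_rg_rg tight_rg_sr tight_sr_rg tight_sr_sr tight_comp_rg tight_comp_sr
  tight_rg_comp tight_sr_comp tight_compA.

Lemma tight_rg_inv x : rg (tight_inv x) = sr x.
Proof.
rewrite /rg /sr /=.
have [s [F [sF ->]]] := germP x.
rewrite tight_inv_germ tight_rng_germ tight_src_germ.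
by apply: germ_idem; [exact: idem_ss'|exact: idem_ss|exact: thetaK].
Qed.

Lemma tight_sr_inv x : sr (tight_inv x) = rg x.
Proof.
rewrite /rg /sr /=.
have [s [F [sF ->]]] := germP x.
rewrite tight_inv_germ tight_rng_germ tight_src_germ.
by apply: germ_idem => //; [exact: idem_ss|exact: idem_ss'].
Qed.

Lemma tight_compV x : x ** tight_inv x = rg x.
Proof.
rewrite /ccomp /rg /=.
have [s [F [sF ->]]] := germP x.
rewrite tight_inv_germ tight_rng_germ.
by rewrite (tight_comp_germ _ _ (theta_dom_rng sF)) // thetaK.
Qed.

Lemma tight_compVx x : tight_inv x ** x = sr x.
Proof.
rewrite /ccomp /sr /=.
have [s [F [sF ->]]] := germP x.
rewrite tight_inv_germ tight_src_germ.
by rewrite (tight_comp_germ _ _ (theta_dom_src sF)).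
Qed.

HB.instance Definition _ := Category_isGroupoid.Build (tight_groupoid S)
  tight_rg_inv tight_sr_inv tight_compV tight_compVx.

Definition slice s (U : set (Etight S)) : set (tight_groupoid S) :=
  [set x | exists F (sF : theta_dom s F), U F /\ x = germ sF].

HB.instance Definition _ := isSubBaseTopological.Build (tight_groupoid S)
  [set V | exists s U, [/\ open U, U `<=` theta_dom s & V = slice s U]] id.

End TightGroupoid.

(* Main.v *)
(** Two germs [s, F] and [t, F] can fail to be separated only if F is a limit of
    tight filters containing an idempotent on which s and t agree.  So the tight
    groupoid is Hausdorff as soon as the idempotents on which s and t agree have
    a greatest element.  In S_{G,Lambda}, viewed as partial bijections of
    Lambda x G, s and t agree at p exactly when p is a fixed point of s^* t, and
    pseudo-freeness forces the fixed points of a triple (m, g, n) to vanish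
    unless g = 1 and m = n: the triples (m, 1, m) of s^* t thus form the greatest
    such idempotent. *)

Require Import Defs.
From mathcomp Require Import all_boot all_algebra all_classical topology.
From mathcomp Require Import finmap.

Set Implicit Arguments.
Unset Strict Implicit.
Unset Printing Implicit Defensive.

Local Open Scope classical_set_scope.
Local Open Scope group_scope.

Section HausdorffCriterion.
Context {S : invSemigroup0Type}.
Implicit Types (s t d e f : S) (F H : Etight S) (x y : tight_groupoid S).

Lemma idem_szero : idem (szero : S).
Proof. exact: mul0s. Qed.

Lemma open_slice s (U : set (Etight S)) : open U -> U `<=` theta_dom s ->
  open (slice s U).
Proof.
move=> oU Us; exists [set slice s U]; last by rewrite bigcup_set1.
move=> _ ->; exists [fset slice s U]%fset.
  by move=> V /fset1P ->; apply/mem_set; exists s, U.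
apply/seteqP; split => [x h|x hx y /fset1P -> //].
exact: (h (slice s U) (fset11 _)).
Qed.

Lemma tight_setM F e f : idem e -> idem f ->
  tight_set F (e * f) <-> tight_set F e /\ tight_set F f.
Proof.
move=> ee ff; have [_ _ FM FU _] := tightP F; split=> [Fef|[]]; last exact: FM.
by split; apply: FU Fef _ _ => //; [exact: ileMl|exact: ileMr].
Qed.

(** Taking [f = szero] or [e = s^* * s] makes the corresponding condition automatic, so one
    neighbourhood serves every separation below. *)
Lemma nbhs_slice s e f F (sF : theta_dom s F) : idem e -> idem f ->
  tight_set F e -> ~ tight_set F f ->
  nbhs (germ sF)
    (slice s [set H | [/\ theta_dom s H, tight_set H e & ~ tight_set H f]]).
Proof.
move=> ee ff Fe Ff; apply: open_nbhs_nbhs; split; last by exists F, sF.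
apply: open_slice => [|H []//].
have si := idem_ss s.
(* A filter contains a product of idempotents iff it contains both, so one idempotent encodes the
   domain and [e]. *)
exists (Ehat0_basic (s^* * s * e) [:: f]).
  apply: open_Ehat0_basic; first exact: idem_mul.
  by move=> _ /[!inE]/eqP->.
apply/seteqP; split=> H /=.
  by move=> [/(tight_setM H si ee)[sH He] /(_ f (mem_head _ _))].
move=> [sH He Hf]; split; first exact/(tight_setM H si ee).
by move=> _ /[!inE]/eqP->.
Qed.

(** Equal germs have equal source filters, so slices over filters containing [e] and over filters
    omitting [e] are disjoint. *)
Lemma cluster_germ_sub s t F H (sF : theta_dom s F) (tH : theta_dom t H) :
  cluster (nbhs (germ sF)) (germ tH) -> tight_set F `<=` tight_set H.
Proof.
move=> cl e Fe; have [_ FE _ _ F0] := tightP F; have ee := FE _ Fe.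
apply: contrapT => He.
have [x [[K [sK [[_ Ke _] ->]]] [K' [tK [[_ _ K'e] /germ_eqP[KK' _]]]]]] := cl _ _
  (nbhs_slice sF ee idem_szero Fe F0) (nbhs_slice tH (idem_ss t) ee tH He).
by apply: K'e; rewrite -KK'.
Qed.

(** The bound [ile e (s^* * s)] excludes idempotents annihilated by both [s] and [t], which need not
    lie below [d]. *)
Lemma hausdorff_tight_groupoid :
  (forall s t, exists d, [/\ idem d, s * d = t * d &
    forall e, idem e -> ile e (s^* * s) -> s * e = t * e -> ile e d]) ->
  hausdorff_space (tight_groupoid S).
Proof.
move=> hS x y.
have [s [F [sF ->]]] := germP x; have [t [H [tH ->]]] := germP y => cl.
have HF : F = H.
  apply: tight_set_inj; apply/seteqP; split; first exact: (cluster_germ_sub cl).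
  apply: (@cluster_germ_sub t s H F tH sF).
  by move=> B C tB sC; rewrite setIC; exact: cl.
subst H; apply/germ_eqP; split => //.
have [d [dd std dmax]] := hS s t; exists d => //.
(* If [F] omits [d], the two slices over filters omitting [d] share a germ at some [K]; agreement on
   [e] in [K] puts [e * (s^* * s)] below [d], forcing [d] into [K]. *)
apply: contrapT => Fd.
have [_ [[K [sK [[_ _ Kd] ->]]] [K' [tK [_ /germ_eqP[KK' [e Ke ste]]]]]]] := cl _ _
  (nbhs_slice sF (idem_ss s) dd sF Fd) (nbhs_slice tH (idem_ss t) dd tH Fd).
have [_ KE KM KU _] := tightP K; have ei := KE _ Ke; have si := idem_ss s.
have Kes : tight_set K (e * (s^* * s)) by exact: KM.
apply: Kd; apply: (KU _ _ Kes dd); apply: dmax.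
- exact: idem_mul.
- exact: ileMr.
- by rewrite !(mulgA _ e) ste.
Qed.

End HausdorffCriterion.

Section PseudoFree.
Context {k : nat} {G : groupType} {L : kgraphType k} (A : self_similar G L).
Implicit Types s t d e u : SGL A.

Lemma sgl_idemP e : idem e <-> forall p q, sgl_rel e p q -> p = q.
Proof.
split=> [ee p q pq|h].
  move: (pq); rewrite -{1}ee => /sgl_rel_mul[x px xq].
  by rewrite (sgl_rel_fun px pq) in xq; exact: sgl_rel_inj pq xq.
apply: sgl_rel_eq => p q; split.
  by move=> /sgl_rel_mul[x /h <-].
by move=> pq; have pE := h _ _ pq; subst q; apply/sgl_rel_mul; exists p.
Qed.

Definition SGL_fix (F : set (L * G * L)) : set (L * G * L) :=
  [set t | [/\ F t, t.1.1 = t.2 & t.1.2 = 1]].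

Lemma SGL_fix_closed F : SGL_carrier A F -> SGL_carrier A (SGL_fix F).
Proof.
move=> [fF sF oF]; split.
- by apply: sub_finite_set fF => t [].
- by move=> m g n [/sF].
- by move=> s t [Fs _ _] [Ft _ _]; exact: oF.
Qed.

Definition sgl_fix u : SGL A :=
  SigSub (mem_set (SGL_fix_closed (set_valP u))).

(** At a fixed point [m ** act A g e = n ** e], and the action preserves degrees, so unique
    factorisation gives [m = n] and [act A g e = e]. The [G] coordinate gives [cocycle A g e = 1],
    whence [g = 1]. *)
Lemma sgl_rel_fix u p q : pseudo_free A ->
  sgl_rel (sgl_fix u) p q <-> sgl_rel u p q /\ p = q.
Proof.
case: p q => [p1 p2] [q1 q2] pf; split.
  move=> [m [g [n [e [[Fn /= mn g1] ne pE qE q2E]]]]]; split.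
    by exists m, g, n, e.
  move: pE qE q2E => /= -> -> ->.
  by rewrite g1 ss_act1 phi1 mul1g mn.
move=> [[m [g [n [e [Fn ne /= pE qE q2E]]]]] [pq p2q]].
have [_ sF _] := set_valP u.
have me : sr m = rg (act A g e) by rewrite (sF _ _ _ Fn) ne ss_act_rg.
have E : m ** act A g e = n ** e by rewrite -qE -pE.
have phi1E : cocycle A g e = 1.
  by apply: (mulIg p2); rewrite mul1g -q2E p2q.
have [mn ge] : m = n /\ act A g e = e.
  apply: ufact => //; apply/ffunP => i.
  have /(congr1 (fun x => deg x i)) := E.
  by rewrite !deg_comp // ss_act_deg !ffunE => /addIn.
have g1 : g = 1 by apply: contrapT => /pf; apply; exists e.
by exists m, g, n, e; split.
Qed.

Lemma sgl_agree s t : pseudo_free A -> exists d, [/\ idem d, s * d = t * d &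
  forall e, idem e -> ile e (s^* * s) -> s * e = t * e -> ile e d].
Proof.
move=> pf; pose d := sgl_fix (s^* * t); exists d.
have dP p q : sgl_rel d p q <->
    (exists2 r, sgl_rel t p r & sgl_rel s p r) /\ p = q.
  rewrite sgl_rel_fix // sgl_rel_mul; split=> -[[r pr qr] E]; subst q; split => //;
    by exists r => //; apply/sgl_rel_star.
have dd : idem d by apply/sgl_idemP => p q /dP[].
split => //.
  apply: sgl_rel_eq => p q; split=> /sgl_rel_mul[x /dP[[r tr sr] <-] pq];
    apply/sgl_rel_mul; exists p; try by apply/dP; split => //; exists r.
    by rewrite (sgl_rel_fun pq sr).
  by rewrite (sgl_rel_fun pq tr).
move=> e ee es ste; apply: sgl_rel_eq => p q; split.
  by move=> /sgl_rel_mul[x /dP[_ <-]].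
move=> pq; have E := (sgl_idemP e).1 ee _ _ pq; subst q.
apply/sgl_rel_mul; exists p => //; apply/dP; split => //.
(* The bound by [s^* * s] puts [p] in the domain of [s]; then [s * e = t * e] gives [t] the same
   value there. *)
move: (pq); rewrite -es => /sgl_rel_mul[x /sgl_rel_mul[r pr _] _].
have /sgl_rel_mul[y /((sgl_idemP e).1 ee) <- tr] : sgl_rel (t * e) p r.
  by rewrite -ste; apply/sgl_rel_mul; exists p.
by exists r.
Qed.

End PseudoFree.

Theorem corollary5p4 (k : nat) (G : groupType) (L : kgraphType k)
    (A : self_similar G L) :
  pseudo_free A -> hausdorff_space (tight_groupoid (SGL A)).
Proof.
by move=> pf; apply: hausdorff_tight_groupoid => s t; exact: sgl_agree.
Qed.
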